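(* Let $u$ be a nonconstant inner function, and let $\varphi\in L^\infty(\mathbb{T})$ be such that the dual truncated Toeplitz operator $D_\varphi$ on $\mathcal{K}_u^\perp$ is normal. Then \[ \operatorname{dist}\bigl(0,\operatorname{convex}(\operatorname{ess\,ran}(\varphi))\bigr)\le m(D_\varphi)\le \operatorname*{ess\,inf}_{z\in\mathbb{T}}|\varphi(z)|. \]
   Context: $L^2=L^2(\mathbb{T})$ with normalized Lebesgue measure $\mu$ on the unit circle $\mathbb{T}$; $H^2\subset L^2$ is the Hardy space. An inner function is a bounded analytic function $u$ on the unit disc with $|u|=1$ a.e. on $\mathbb{T}$. The model space is $\mathcal{K}_u=H^2\ominus uH^2$, with orthogonal projection $P_{\mathcal{K}_u}$ of $L^2$ onto it, and $\mathcal{K}_u^\perp$ is its orthogonal complement in $L^2$. For $\varphi\in L^\infty(\mathbb{T})$, $D_\varphi:\mathcal{K}_u^\perp\to\mathcal{K}_u^\perp$ is $D_\varphi f=(I-P_{\mathcal{K}_u})(\varphi f)$. The essential range is $\operatorname{ess\,ran}(\varphi)=\{\lambda\in\mathbb{C}:\forall\varepsilon>0,\ \mu(\{z:|\varphi(z)-\lambda|<\varepsilon\})>0\}$, $\operatorname{convex}$ denotes convex hull, and $\operatorname{dist}(0,A)=\inf_{\lambda\in A}|\lambda|$. The minimum modulus is $m(T)=\inf\{\|Tx\|:\|x\|=1\}$. *)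

(* Defs.v *)
From HB Require Import structures.
From mathcomp Require Import all_boot all_order all_algebra.
From mathcomp Require Import all_classical all_reals all_analysis.
From mathcomp Require Import complex.

Set Implicit Arguments.
Unset Strict Implicit.
Unset Printing Implicit Defensive.

Import Order.TTheory GRing.Theory Num.Theory.
Import numFieldNormedType.Exports.
Import ComplexField.Normc.

Local Open Scope classical_set_scope.
Local Open Scope ring_scope.
Local Open Scope complex_scope.

Definition circle (R : realType) : Type := {z : R[i] | normc z == 1}.

Section circle.
Variable R : realType.

HB.instance Definition _ := Choice.on (circle R).

Definition expi_val (t : R) : R[i] := cos (2 * pi * t) +i* sin (2 * pi * t).

Lemma expi_subproof (t : R) : normc (expi_val t) == 1.
Proof. by rewrite /= cos2Dsin2 sqrtr1. Qed.

Definition expi (t : R) : circle R := exist _ (expi_val t) (expi_subproof t).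

HB.instance Definition _ := isPointed.Build (circle R) (expi 0).

(* Image of the Borel sigma-algebra of [R] by the covering map
   [t |-> exp (2 * pi * i * t)]; it is the Borel sigma-algebra of the circle. *)
Definition circle_measurable : set (set (circle R)) :=
  image_set_system setT expi measurable.

Lemma circle_measurable0 : circle_measurable set0.
Proof. by rewrite /circle_measurable /image_set_system /= preimage_set0 setI0. Qed.

Lemma circle_measurableC A : circle_measurable A -> circle_measurable (~` A).
Proof.
rewrite /circle_measurable /image_set_system /= !setTI -preimage_setC.
exact: measurableC.
Qed.

Lemma circle_measurable_bigcup (F : (set (circle R))^nat) :
  (forall i, circle_measurable (F i)) -> circle_measurable (\bigcup_i F i).
Proof.
rewrite /circle_measurable /image_set_system /= => mF.
rewrite setTI preimage_bigcup; apply: bigcupT_measurable => i.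
by have := mF i; rewrite setTI.
Qed.

HB.instance Definition _ := isMeasurable.Build default_measure_display
  (circle R) circle_measurable0 circle_measurableC circle_measurable_bigcup.

Lemma measurable_expi : measurable_fun [set: R] expi.
Proof. by move=> _ A; rewrite /measurable/=. Qed.

(* Normalized Lebesgue measure on the circle. *)
Definition circle_measure : set (circle R) -> \bar R :=
  pushforward (mrestr (@lebesgue_measure R) (measurable_itv `[0, 1[)) expi.

Local Notation mu := circle_measure.

Let circle_measure0 : mu set0 = 0%E.
Proof. by rewrite /mu /pushforward preimage_set0 measure0. Qed.

Let circle_measure_ge0 A : (0 <= mu A)%E.
Proof. exact: measure_ge0. Qed.

Let circle_measure_sigma_additive : semi_sigma_additive mu.
Proof.
move=> F mF tF mUF; rewrite /mu /pushforward preimage_bigcup.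
have mexpi A : measurable A -> measurable (expi @^-1` A).
  by move=> mA; rewrite -[X in measurable X]setTI; exact: measurable_expi.
apply: measure_semi_sigma_additive.
- by move=> n; exact: mexpi.
- apply/trivIsetP => i j _ _ ij; rewrite -preimage_setI.
  by move/trivIsetP : tF => /(_ _ _ _ _ ij) ->//; rewrite preimage_set0.
- by rewrite -preimage_bigcup; exact: mexpi.
Qed.

HB.instance Definition _ := isMeasure.Build _ _ _ mu
  circle_measure0 circle_measure_ge0 circle_measure_sigma_additive.

Let circle_measure_setT : mu [set: circle R] = 1%E.
Proof.
rewrite /mu /pushforward preimage_setT /mrestr setTI.
by rewrite /= lebesgue_measure_itv/= lte_fin ltr01 oppr0 adde0.
Qed.

HB.instance Definition _ :=
  Measure_isProbability.Build _ _ _ mu circle_measure_setT.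

End circle.

Arguments circle_measure {R}.

Section function_spaces.
Variable R : realType.
Local Notation C := R[i].
Local Notation T := (circle R).
Local Notation mu := (@circle_measure R).
Implicit Types f g h : T -> C.

(* Elements of L^p are represented by functions; two of them denote the same
   element when they are equal [%[ae mu]]. *)

Definition cnorm (p : \bar R) f : \bar R :=
  Lnorm mu p (fun z => (normc (f z))%:E).

Definition Lp (p : \bar R) : set (T -> C) :=
  [set f | [/\ measurable_fun setT (fun z => complex.Re (f z)),
              measurable_fun setT (fun z => complex.Im (f z))
            & (cnorm p f < +oo)%E]].

Definition cintegral f : C :=
  (\int[mu]_z complex.Re (f z)) +i* (\int[mu]_z complex.Im (f z)).

Definition cdot f g : C := cintegral (fun z => f z * conjc (g z)).

Definition orthocompl (K : set (T -> C)) : set (T -> C) :=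
  [set f | Lp 2%:E f /\ forall g, K g -> cdot f g = 0].

(* [Lp 2%:E] being a Hilbert space modulo a.e. equality, this is the orthogonal
   projection of [f] whenever [K] is a closed subspace: the projection is then
   characterized, up to a.e. equality, by the predicate below. *)
Definition orthoproj (K : set (T -> C)) f : T -> C :=
  xget (cst 0) [set g | K g /\ orthocompl K (fun z => f z - g z)].

(* H^2: the square-integrable functions without negative Fourier
   coefficients. *)
Definition hardy2 : set (T -> C) :=
  [set f | Lp 2%:E f /\
    forall n, cintegral (fun z => f z * sval z ^+ n.+1) = 0].

(* The radial limit, which exists a.e. for bounded analytic functions. *)
Definition radial_lim (u : C -> C) (z : T) : C :=
  lim ((u (r%:C * sval z) : C^o) @[r --> (1 : R)^'-]).

Definition analytic_on_disc (u : C -> C) :=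
  forall z : C, normc z < 1 -> derivable (u : C^o -> C^o) z 1.

Definition inner_function (u : C -> C) :=
  [/\ analytic_on_disc u,
      exists M : R, forall z, normc z < 1 -> normc (u z) <= M
    & \forall z \ae mu, cvg ((u (r%:C * sval z) : C^o) @[r --> (1 : R)^'-]) /\
                        normc (radial_lim u z) = 1].

Definition constant_on_disc (u : C -> C) :=
  exists c, forall z, normc z < 1 -> u z = c.

Definition inner_mul_hardy2 (u : C -> C) : set (T -> C) :=
  [set f | Lp 2%:E f /\ exists2 h, hardy2 h &
    f = (fun z => radial_lim u z * h z) %[ae mu]].

Definition model_space (u : C -> C) : set (T -> C) :=
  hardy2 `&` orthocompl (inner_mul_hardy2 u).

Definition model_space_perp (u : C -> C) : set (T -> C) :=
  orthocompl (model_space u).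

(* The formula for D_phi; as an operator it acts on [model_space_perp u]. *)
Definition dual_truncated_toeplitz (u : C -> C) (phi : T -> C) f : T -> C :=
  fun z => phi z * f z - orthoproj (model_space u) (fun w => phi w * f w) z.

(* [B] is the Hilbert space adjoint of the restriction of [A] to [H]. *)
Definition is_adjoint (H : set (T -> C)) (A B : (T -> C) -> (T -> C)) :=
  (forall f, H f -> H (B f)) /\
  forall f g, H f -> H g -> cdot (A f) g = cdot f (B g).

Definition normal_operator (H : set (T -> C)) (A : (T -> C) -> (T -> C)) :=
  exists2 B, is_adjoint H A B &
    forall f, H f -> A (B f) = B (A f) %[ae mu].

Definition min_modulus (H : set (T -> C)) (A : (T -> C) -> (T -> C)) : \bar R :=
  ereal_inf [set cnorm 2%:E (A f) | f in H `&` [set f | cnorm 2%:E f = 1%E]].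

Definition ess_ran (phi : T -> C) : set C :=
  [set l | forall e : R, 0 < e ->
    (0 < mu [set z | (normc (phi z - l) < e)%R])%E].

(* [Rcomplex R] is [R[i]] viewed as a real vector space. *)
Definition convex_hull (A : set C) : set C :=
  smallest (@convex_set R (Rcomplex R)) A.

Definition dist0 (A : set C) : \bar R := ereal_inf [set (normc l)%:E | l in A].

End function_spaces.

(* Main.v *)
(* The lower bound is a numerical range estimate: for a unit vector [f] of the
   complement, <D f, f> = <phi f, f> is an average of the values of [phi], so the
   half plane separating the convex hull of the essential range from a disc
   around 0 also contains <D f, f>.

   For the upper bound, a polynomial [p] in [z] multiplied by a high power of
   [conjc z] is orthogonal to the Hardy space, hence lies in the complement, and
   [D] contracts [phi f]. Therefore [m ^ 2 * int |p| ^ 2 <= int |phi| ^ 2 |p| ^ 2]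
   for all polynomials. The moduli of the polynomials [cutoff_poly] converge
   boundedly to the indicator of an arc, so [|phi| ^ 2 - m ^ 2] has a nonnegative
   mean on every small arc and is nonnegative at its Lebesgue points. *)
Require Import Defs.
From mathcomp Require Import all_boot all_order all_algebra.
From mathcomp Require Import all_classical all_reals all_analysis.
From mathcomp Require Import ess_sup_inf measurable_realfun.
From mathcomp Require Import complex.
From mathcomp Require Import ring lra.
Import ComplexField.Normc.

Set Implicit Arguments.
Unset Strict Implicit.
Unset Printing Implicit Defensive.

Import Order.TTheory GRing.Theory Num.Theory.
Import numFieldNormedType.Exports.

Local Open Scope classical_set_scope.
Local Open Scope ring_scope.

(** * Square-integrable functions on the circle *)

Section square_norm.
Variable R : realType.
Local Notation C := R[i].
Implicit Types v w : C.

(** The squared modulus, kept polynomial in the coordinates so that identities and estimates fall to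
    [ring] and [nra] without square roots. *)
Definition nsq w : R := complex.Re w ^+ 2 + complex.Im w ^+ 2.

Lemma nsq_ge0 w : 0 <= nsq w.
Proof. by rewrite addr_ge0 ?sqr_ge0. Qed.

Lemma normcE w : normc w = Num.sqrt (nsq w).
Proof. by case: w. Qed.

Lemma sqr_normc w : normc w ^+ 2 = nsq w.
Proof. by rewrite normcE sqr_sqrtr ?nsq_ge0. Qed.

Lemma normc_ge0 w : 0 <= normc w.
Proof. by rewrite normcE sqrtr_ge0. Qed.

Lemma nsqM v w : nsq (v * w) = nsq v * nsq w.
Proof. by rewrite -!sqr_normc normcM exprMn. Qed.

Lemma nsqX w n : nsq (w ^+ n) = nsq w ^+ n.
Proof.
elim: n => [|n IH]; last by rewrite !exprS nsqM IH.
by rewrite !expr0 /nsq /= expr1n expr0n addr0.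
Qed.

Lemma nsq_conj w : nsq (conjc w) = nsq w.
Proof. by case: w => a b; rewrite /nsq /= sqrrN. Qed.

Lemma ReM v w : complex.Re (v * w) =
  complex.Re v * complex.Re w - complex.Im v * complex.Im w.
Proof. by case: v w => [a b] [c d]. Qed.

Lemma ImM v w : complex.Im (v * w) =
  complex.Re v * complex.Im w + complex.Im v * complex.Re w.
Proof. by case: v w => [a b] [c d]. Qed.

Lemma ReD v w : complex.Re (v + w) = complex.Re v + complex.Re w.
Proof. by case: v w => [a b] [c d]. Qed.

Lemma ImD v w : complex.Im (v + w) = complex.Im v + complex.Im w.
Proof. by case: v w => [a b] [c d]. Qed.

Lemma ReN w : complex.Re (- w) = - complex.Re w.
Proof. by case: w. Qed.

Lemma ImN w : complex.Im (- w) = - complex.Im w.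
Proof. by case: w. Qed.

Lemma Re_conj w : complex.Re (conjc w) = complex.Re w.
Proof. by case: w. Qed.

Lemma Im_conj w : complex.Im (conjc w) = - complex.Im w.
Proof. by case: w. Qed.

Definition ReImE := (ReM, ImM, ReD, ImD, ReN, ImN, Re_conj, Im_conj).

(** A weak form of Young's inequality, read off from squares of sums and differences; it dominates a
    product of two square-integrable functions by an integrable one. *)
Lemma normr_ReM v w : `|complex.Re (v * w)| <= nsq v + nsq w.
Proof.
rewrite ReM /nsq ler_norml.
move: (complex.Re v) (complex.Im v) (complex.Re w) (complex.Im w) => a b c d.
have := sqr_ge0 (a - c); have := sqr_ge0 (b + d).
have := sqr_ge0 (a + c); have := sqr_ge0 (b - d).
have := sqr_ge0 a; have := sqr_ge0 b; have := sqr_ge0 c; have := sqr_ge0 d.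
by rewrite !expr2 => *; nra.
Qed.

Lemma normr_ImM v w : `|complex.Im (v * w)| <= nsq v + nsq w.
Proof.
(* The left factor on the right-hand side is [v] multiplied by -i, which turns imaginary parts into
   real parts. *)
have -> : complex.Im (v * w) = complex.Re ((complex.Im v -i* complex.Re v)%C * w).
  by rewrite ReM /= ImM; ring.
apply: le_trans (normr_ReM _ _) _.
by rewrite /nsq /= sqrrN [_ ^+ 2 + complex.Re v ^+ 2]addrC.
Qed.

Lemma nsqD_le v w : nsq (v + w) <= 2 * (nsq v + nsq w).
Proof.
rewrite /nsq !ReImE.
move: (complex.Re v) (complex.Im v) (complex.Re w) (complex.Im w) => a b c d.
by have := sqr_ge0 (a - c); have := sqr_ge0 (b - d); rewrite !expr2; nra.
Qed.

End square_norm.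

Section L2.
Variable R : realType.
Local Notation C := R[i].
Local Notation T := (circle R).
Local Notation mu := (@circle_measure R).
Implicit Types f g h : T -> C.

Definition cmeasurable f :=
  measurable_fun setT (fun z => complex.Re (f z)) /\
  measurable_fun setT (fun z => complex.Im (f z)).

Lemma cmeasurable_cst (c : C) : cmeasurable (fun=> c).
Proof. by split; exact: measurable_cst. Qed.

Lemma cmeasurableM f g : cmeasurable f -> cmeasurable g ->
  cmeasurable (fun z => f z * g z).
Proof.
move=> [rf jf] [rg jg]; split.
  under eq_fun do rewrite ReM.
  by apply: measurable_funB; exact: measurable_funM.
under eq_fun do rewrite ImM.
by apply: measurable_funD; exact: measurable_funM.
Qed.

Lemma cmeasurableD f g : cmeasurable f -> cmeasurable g ->
  cmeasurable (fun z => f z + g z).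
Proof.
move=> [rf jf] [rg jg]; split.
  by under eq_fun do rewrite ReD; exact: measurable_funD.
by under eq_fun do rewrite ImD; exact: measurable_funD.
Qed.

Lemma cmeasurableN f : cmeasurable f -> cmeasurable (fun z => - f z).
Proof.
move=> [rf jf]; split.
  by under eq_fun do rewrite ReN; exact: measurableT_comp.
by under eq_fun do rewrite ImN; exact: measurableT_comp.
Qed.

Lemma cmeasurable_conj f : cmeasurable f -> cmeasurable (fun z => conjc (f z)).
Proof.
move=> [rf jf]; split.
  by under eq_fun do rewrite Re_conj.
by under eq_fun do rewrite Im_conj; exact: measurableT_comp.
Qed.

Lemma measurable_nsq f : cmeasurable f -> measurable_fun setT (fun z => nsq (f z)).
Proof. by move=> [rf jf]; apply: measurable_funD; exact: measurable_funX. Qed.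

Lemma cnorm2E f : cnorm 2%:E f = ((\int[mu]_z (nsq (f z))%:E) `^ 2^-1)%E.
Proof.
rewrite /cnorm unlock; congr (_ `^ _)%E; apply: eq_integral => z _ /=.
by rewrite ger0_norm ?normc_ge0// powR_mulrn ?normc_ge0// sqr_normc.
Qed.

Definition nsq_integrable f := mu.-integrable setT (EFin \o (fun z => nsq (f z))).

Lemma Lp2P f : Lp 2%:E f <-> cmeasurable f /\ nsq_integrable f.
Proof.
rewrite /Lp /= cnorm2E; split.
  move=> [rf jf nf]; split=> //; apply/integrableP; split.
    by apply/measurable_EFinP; exact: measurable_nsq.
  under eq_integral do rewrite /= ger0_norm ?nsq_ge0//.
  by apply: lty_poweRy nf; rewrite invr_neq0.
move=> [[rf jf] /integrableP[_]].
under eq_integral do rewrite /= ger0_norm ?nsq_ge0//.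
by move=> nf; split => //; exact: poweR_lty.
Qed.

Lemma cnorm2_sqrt f : Lp 2%:E f ->
  cnorm 2%:E f = (Num.sqrt (\int[mu]_z nsq (f z)))%:E.
Proof.
move=> /Lp2P[_ nf]; have /fineK fE := integrable_fin_num measurableT nf.
rewrite cnorm2E -[X in (X `^ _)%E]fE poweR_EFin powR12_sqrt//.
by rewrite fine_ge0// integral_ge0// => z _; rewrite lee_fin nsq_ge0.
Qed.

Lemma nsq_integral_ge0 f : 0 <= \int[mu]_z nsq (f z).
Proof. by apply: Rintegral_ge0 => z _; exact: nsq_ge0. Qed.

Lemma le_nsq_integrable f g k : cmeasurable f ->
  mu.-integrable setT (EFin \o k) -> (forall z, nsq (f z) <= k z) ->
  nsq_integrable f.
Proof.
move=> mf ik fk; apply: le_integrable ik => //.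
  by apply/measurable_EFinP; exact: measurable_nsq.
move=> z _ /=; rewrite lee_fin ger0_norm ?nsq_ge0//.
exact: le_trans (ler_norm _).
Qed.

Lemma L2D f g : Lp 2%:E f -> Lp 2%:E g -> Lp 2%:E (fun z => f z + g z).
Proof.
move=> /Lp2P[mf nf] /Lp2P[mg ng]; apply/Lp2P; split; first exact: cmeasurableD.
pose k z := 2 * (nsq (f z) + nsq (g z)).
apply: (@le_nsq_integrable _ f k); first exact: cmeasurableD.
  have -> : EFin \o k = (fun z => 2%:E * ((EFin \o (fun z => nsq (f z))) \+
      (EFin \o (fun z => nsq (g z)))) z)%E by apply/funext => z.
  by apply: integrableZl => //; exact: integrableD.
by move=> z; exact: nsqD_le.
Qed.

Lemma L2N f : Lp 2%:E f -> Lp 2%:E (fun z => - f z).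
Proof.
move=> /Lp2P[mf nf]; apply/Lp2P; split; first exact: cmeasurableN.
by apply: eq_integrable nf => // z _ /=; rewrite /nsq ReN ImN !sqrrN.
Qed.

Lemma L2_conj f : Lp 2%:E f -> Lp 2%:E (fun z => conjc (f z)).
Proof.
move=> /Lp2P[mf nf]; apply/Lp2P; split; first exact: cmeasurable_conj.
by apply: eq_integrable nf => // z _ /=; rewrite nsq_conj.
Qed.

Lemma L2M_bounded f g (M : R) : cmeasurable f ->
  (\forall z \ae mu, nsq (f z) <= M) -> Lp 2%:E g ->
  Lp 2%:E (fun z => f z * g z).
Proof.
move=> mf fM /Lp2P[mg ng]; have mfg := cmeasurableM mf mg.
have mE : measurable_fun setT (EFin \o (fun z => nsq (f z * g z))).
  by apply/measurable_EFinP; exact: (measurable_nsq mfg).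
apply/Lp2P; split => //; apply/integrableP; split => //.
have := integrableZl measurableT M ng => /integrableP[mk]; apply: le_lt_trans.
apply: ae_ge0_le_integral => //.
- exact: measurableT_comp.
- exact: measurableT_comp.
apply: filterS fM => z fM _ /=.
rewrite lee_fin normrM !ger0_norm ?nsq_ge0// ?(le_trans _ fM)// ?nsq_ge0//.
by rewrite nsqM ler_wpM2r ?nsq_ge0.
Qed.

Lemma L2M_integrable f g : Lp 2%:E f -> Lp 2%:E g ->
  mu.-integrable setT (EFin \o (fun z => complex.Re (f z * g z))) /\
  mu.-integrable setT (EFin \o (fun z => complex.Im (f z * g z))).
Proof.
move=> /Lp2P[mf nf] /Lp2P[mg ng]; have [mr mi] := cmeasurableM mf mg.
have nfg := integrableD measurableT nf ng.
split; apply: le_integrable nfg => //; do ?exact/measurable_EFinP.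
  move=> z _ /=; rewrite lee_fin (ger0_norm (addr_ge0 (nsq_ge0 _) (nsq_ge0 _))).
  exact: normr_ReM.
move=> z _ /=; rewrite lee_fin (ger0_norm (addr_ge0 (nsq_ge0 _) (nsq_ge0 _))).
exact: normr_ImM.
Qed.

Definition cintegrable f :=
  mu.-integrable setT (EFin \o (fun z => complex.Re (f z))) /\
  mu.-integrable setT (EFin \o (fun z => complex.Im (f z))).

Lemma cintegralD f g : cintegrable f -> cintegrable g ->
  cintegral (fun z => f z + g z) = cintegral f + cintegral g.
Proof.
move=> [rf jf] [rg jg]; apply/eqP; rewrite eq_complex /= -!RintegralD//.
by apply/andP; split; apply/eqP; apply: eq_Rintegral => z _; rewrite ReImE.
Qed.

Lemma cintegralZ (c : C) f : cintegrable f ->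
  cintegral (fun z => c * f z) = c * cintegral f.
Proof.
move=> [rf jf]; apply/eqP; rewrite eq_complex ReM ImM /=.
have rZ := fun r => integrableZl measurableT r rf.
have jZ := fun r => integrableZl measurableT r jf.
rewrite -!RintegralZl// -RintegralB// -?RintegralD//;
  try by [exact: rZ | exact: jZ].
by apply/andP; split; apply/eqP; apply: eq_Rintegral => z _; rewrite ReImE.
Qed.

Lemma cintegrableZ (c : C) f : cintegrable f -> cintegrable (fun z => c * f z).
Proof.
move=> [rf jf].
have rZ := fun r => integrableZl measurableT r rf.
have jZ := fun r => integrableZl measurableT r jf.
split.
  apply: eq_integrable (integrableB _ (rZ (complex.Re c)) (jZ (complex.Im c))) => //.
  by move=> z _ /=; rewrite ReM.
apply: eq_integrable (integrableD _ (jZ (complex.Re c)) (rZ (complex.Im c))) => //.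
by move=> z _ /=; rewrite ImM.
Qed.

Lemma cintegral_conj f : cintegrable f ->
  cintegral (fun z => conjc (f z)) = conjc (cintegral f).
Proof.
move=> [rf jf]; apply/eqP; rewrite eq_complex /=.
apply/andP; split; apply/eqP.
  by apply: eq_Rintegral => z _; rewrite Re_conj.
under eq_Rintegral do rewrite Im_conj -mulN1r.
by rewrite RintegralZl// mulN1r.
Qed.

End L2.

(** * Polynomials and orthogonal projections *)

Section circle_functions.
Variable R : realType.
Local Notation C := R[i].
Local Notation T := (circle R).
Local Notation mu := (@circle_measure R).
Implicit Types f g h : T -> C.

(** The sigma-algebra of the circle is the image one under [expi], so a preimage is measurable
    exactly when its pullback to the line is. *)
Lemma measurable_circle (f : T -> R) :
  measurable_fun setT (f \o @expi R) -> measurable_fun setT f.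
Proof. by move=> mf _ A mA; rewrite setTI; exact: mf. Qed.

Lemma nsq_circle (z : T) : nsq (sval z) = 1.
Proof. by case: z => z /= /eqP z1; rewrite -sqr_normc z1 expr1n. Qed.

Lemma conj_circleM (z : T) : conjc (sval z) * sval z = 1.
Proof.
have := nsq_circle z; case: z => -[a b] /= _ ab.
by apply/eqP; rewrite eq_complex ReM ImM /=; apply/andP; split; apply/eqP;
  [rewrite -ab /nsq /=|]; ring.
Qed.

Lemma cmeasurable_circle : cmeasurable (fun z : T => sval z).
Proof.
have m2pi : measurable_fun setT (fun t : R => 2 * pi * t).
  exact: measurable_funM.
split; apply: measurable_circle.
  apply: (measurableT_comp _ m2pi).
  by apply: continuous_measurable_fun; exact: continuous_cos.
apply: (measurableT_comp _ m2pi).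
by apply: continuous_measurable_fun; exact: continuous_sin.
Qed.

Lemma cmeasurableX f n : cmeasurable f -> cmeasurable (fun z => f z ^+ n).
Proof.
move=> mf; elim: n => [|n IH]; first exact: cmeasurable_cst.
by under eq_fun do rewrite exprS; exact: cmeasurableM.
Qed.

Lemma L2_cst (c : C) : Lp 2%:E (fun _ : T => c).
Proof.
apply/Lp2P; split; first exact: cmeasurable_cst.
apply: measurable_bounded_integrable => //.
  by rewrite (le_lt_trans (probability_le1 _ _)) ?ltry.
exact: bounded_cst.
Qed.

Lemma L2M_circle f n : Lp 2%:E f -> Lp 2%:E (fun z : T => sval z ^+ n * f z).
Proof.
apply: (@L2M_bounded _ _ _ 1); first exact: cmeasurableX cmeasurable_circle.
by apply: aeW => z; rewrite nsqX nsq_circle expr1n.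
Qed.

Lemma L2M_conj_circle f n : Lp 2%:E f ->
  Lp 2%:E (fun z : T => conjc (sval z) ^+ n * f z).
Proof.
apply: (@L2M_bounded _ _ _ 1).
  exact/cmeasurableX/cmeasurable_conj/cmeasurable_circle.
by apply: aeW => z; rewrite nsqX nsq_conj nsq_circle expr1n.
Qed.

Lemma L2_poly (p : {poly C}) : Lp 2%:E (fun z : T => p.[sval z]).
Proof.
elim/poly_ind: p => [|p c IH].
  by under eq_fun do rewrite horner0; exact: L2_cst.
under eq_fun do rewrite hornerMXaddC mulrC -[X in X * _]expr1.
by apply: L2D (L2_cst _); exact: L2M_circle.
Qed.

Lemma L2_cintegrable f : Lp 2%:E f -> cintegrable f.
Proof.
move=> Lf; have := L2M_integrable (L2_cst 1) Lf.
by under eq_fun do rewrite mul1r; under [in X in _ /\ X]eq_fun do rewrite mul1r.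
Qed.

Lemma cdot_integrable f g : Lp 2%:E f -> Lp 2%:E g ->
  cintegrable (fun z => f z * conjc (g z)).
Proof. by move=> Lf Lg; exact: L2M_integrable Lf (L2_conj Lg). Qed.

Lemma cdotDl f g h : Lp 2%:E f -> Lp 2%:E g -> Lp 2%:E h ->
  cdot (fun z => f z + g z) h = cdot f h + cdot g h.
Proof.
move=> Lf Lg Lh; rewrite /cdot -cintegralD; do ?exact: cdot_integrable.
by congr cintegral; apply/funext => z; rewrite mulrDl.
Qed.

Lemma cdot_conj f g : Lp 2%:E f -> Lp 2%:E g -> cdot g f = conjc (cdot f g).
Proof.
move=> Lf Lg; rewrite -cintegral_conj; last exact: cdot_integrable.
congr cintegral; apply/funext => z; rewrite rmorphM /= mulrC.
by congr (_ * _); case: (g z) => a b /=; rewrite opprK.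
Qed.

(** As conj z = 1/z on the circle, only the powers of z from -n to -1 occur. The induction follows
    Horner's scheme: the constant term [c] contributes a multiple of the conjugate of the integral
    of [sval z ^+ n.+1 * g z], which vanishes for [g] in the Hardy space. *)
Lemma orthocompl_hardy2_poly (p : {poly C}) n : (size p <= n)%N ->
  orthocompl (@hardy2 R) (fun z => conjc (sval z) ^+ n * p.[sval z]).
Proof.
move=> pn; split; first exact: L2M_conj_circle (L2_poly p).
move=> g [Lg g0].
have p0 k : cdot (fun z => conjc (sval z) ^+ k * (0 : {poly C}).[sval z]) g = 0.
  rewrite /cdot (_ : (fun _ => _) = (fun z : T => 0 * conjc (g z))).
    by rewrite cintegralZ ?mul0r//; exact/L2_cintegrable/L2_conj.
  by apply/funext => z; rewrite horner0 mulr0.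
elim/poly_ind: p n pn => [//|p c IH [|n]].
  by rewrite leqn0 size_poly_eq0 => /eqP->.
rewrite size_MXaddC; case: ifP => [/andP[/eqP-> /eqP->] _|_].
  by rewrite mul0r add0r.
rewrite ltnS => pn.
have ig : cintegrable (fun z : T => sval z ^+ n.+1 * g z).
  exact/L2_cintegrable/L2M_circle.
have igc : cintegrable (fun z : T => conjc (sval z ^+ n.+1 * g z)).
  exact/L2_cintegrable/L2_conj/L2M_circle.
pose f (z : T) := conjc (sval z) ^+ n * p.[sval z].
rewrite /cdot (_ : (fun _ => _) = (fun z : T => f z * conjc (g z) +
    c * conjc (sval z ^+ n.+1 * g z))).
  rewrite cintegralD; last exact: cintegrableZ.
    rewrite cintegralZ// cintegral_conj//.
    under [X in conjc (cintegral X)]eq_fun do rewrite mulrC.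
    by rewrite g0 -/(cdot f g) IH// add0r (_ : conjc 0 = 0) ?mulr0 ?conjc0.
  by apply: cdot_integrable Lg; exact: L2M_conj_circle (L2_poly p).
apply/funext => z; rewrite hornerMXaddC rmorphM rmorphXn /= /f exprS.
by have := conj_circleM z; move: (conjc (sval z)) => w wz; ring: wz.
Qed.

(** Either [xget] falls back on its default [cst 0], or it returns a genuine projection; the lemmas
    below treat both cases. *)
Lemma orthoprojP (K : set (T -> C)) h :
  orthoproj K h = cst 0 \/
  K (orthoproj K h) /\ orthocompl K (fun z => h z - orthoproj K h z).
Proof. by rewrite /orthoproj; case: xgetP => [g -> ?|_]; [right|left]. Qed.

(** Pythagoras: with g the projection, |h|^2 = |h - g|^2 + |g|^2 + 2 Re((h - g) conj g) pointwise,
    and the cross term has integral 0. *)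
Lemma orthoproj_contract (K : set (T -> C)) h : K `<=` Lp 2%:E -> Lp 2%:E h ->
  Lp 2%:E (fun z => h z - orthoproj K h z) /\
  \int[mu]_z nsq (h z - orthoproj K h z) <= \int[mu]_z nsq (h z).
Proof.
move=> KL Lh; case: (orthoprojP K h) => [->|[Kg [Lk kg]]].
  have h0 : (fun z => h z - cst 0 z) = h by apply/funext => z; rewrite subr0.
  by split; [rewrite h0|under eq_Rintegral do rewrite subr0].
split=> //; set g := orthoproj K h in Kg Lk kg *.
have Lg := KL _ Kg; have [ikg _] := cdot_integrable Lk Lg.
have /Lp2P[_ nh] := Lh; have /Lp2P[_ nk] := Lk.
have i2 := integrableZl measurableT 2 ikg.
have Rkg : \int[mu]_z complex.Re ((h z - g z) * conjc (g z)) = 0.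
  by have := kg _ Kg => /(congr1 (@complex.Re R)).
rewrite -[leRHS]subr0 -(mulr0 2) -Rkg -RintegralZl// -RintegralB//.
apply: le_Rintegral => //; first exact: (integrableB measurableT nh i2).
move=> z _; rewrite -subr_ge0.
rewrite (_ : _ - _ = nsq (g z)) ?nsq_ge0// /nsq !ReImE; ring.
Qed.

Lemma orthoproj_cdot (K : set (T -> C)) f h : K `<=` Lp 2%:E ->
  orthocompl K f -> cdot (orthoproj K h) f = 0.
Proof.
move=> KL [Lf fK]; case: (orthoprojP K h) => [->|[Kg _]].
  rewrite /cdot (_ : (fun _ => _) = (fun z : T => 0 * conjc (f z))) ?cintegralZ ?mul0r//.
  exact/L2_cintegrable/L2_conj.
by rewrite (cdot_conj Lf (KL _ Kg)) fK// conjc0.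
Qed.

End circle_functions.

(** * Essential range and convex hull *)

Section essential_range.
Variable R : realType.
Local Notation C := R[i].
Local Notation T := (circle R).
Local Notation mu := (@circle_measure R).
Implicit Types f g phi : T -> C.

Lemma ltr_normc (w : C) (r : R) : 0 <= r -> (normc w < r) = (nsq w < r ^+ 2).
Proof. by move=> r0; rewrite -sqr_normc ltr_sqr ?nnegrE ?normc_ge0. Qed.

Lemma measurable_disc_preimage phi (c : C) (r : R) : cmeasurable phi -> 0 <= r ->
  measurable [set z | normc (phi z - c) < r].
Proof.
move=> mphi r0.
have mf : measurable_fun setT (fun z => nsq (phi z - c)).
  apply: (measurable_nsq (f := fun z => phi z - c)).
  exact: cmeasurableD mphi (cmeasurable_cst _).
rewrite (_ : [set _ | _] = setT `&` (fun z => nsq (phi z - c)) @^-1` `]-oo, r ^+ 2[).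
  by apply: mf => //; exact: measurable_itv.
by rewrite setTI; apply/seteqP; split => z /=; rewrite in_itv /= ltr_normc.
Qed.

Lemma rat_disc_dense (w : C) (r : R) : 0 < r ->
  exists q : rat * rat, normc (w - (ratr q.1 +i* ratr q.2)%C) < r.
Proof.
move=> r0; pose s := r / 2; have s0 : 0 < s by rewrite divr_gt0.
have rat_near (x : R) : exists q : rat, x - s < ratr q < x + s.
  have /rat_in_itvoo[q] : x - s < x + s by lra.
  by rewrite in_itv; exists q.
have [q1 /andP[q1l q1r]] := rat_near (complex.Re w).
have [q2 /andP[q2l q2r]] := rat_near (complex.Im w).
exists (q1, q2); rewrite ltr_normc ?ltW// /nsq; case: w q1l q1r q2l q2r => a b /=.
move: (ratr q1) (ratr q2) => c d; have rE : r = 2 * s by rewrite /s; field.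
move=> *; rewrite rE; nra.
Qed.

(* Every point outside the essential range lies in one of the countably many
   rational discs with null preimage. *)
Lemma ae_ess_ran phi : cmeasurable phi -> \forall z \ae mu, ess_ran phi (phi z).
Proof.
move=> mphi; pose radius n : R := n.+1%:R^-1.
pose D (i : rat * rat * nat) :=
  [set z | normc (phi z - (ratr i.1.1 +i* ratr i.1.2)%C) < radius i.2].
have rad_ge0 n : 0 <= radius n by rewrite invr_ge0.
pose F k := if unpickle k is Some i then
  if mu (D i) == 0 then D i else set0 else set0.
have : mu.-negligible (\bigcup_k F k).
  apply: negligible_bigcup => k; rewrite /F; case: unpickle => [i|].
    case: eqP => [D0|_]; last exact: negligible_set0.
    by apply/negligibleP; first exact: measurable_disc_preimage.
  exact: negligible_set0.
apply: negligibleS => z /= /existsNP[e /not_implyP[e0 /negP]].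
rewrite -leNgt measure_le0 => /eqP mu0.
(* A rational disc of radius below e / 2 that contains [phi z] lies inside the disc of radius e
   about [phi z], whose preimage is null. *)
have [n ne] : exists n, radius n < e / 2.
  have := near_infty_natSinv_lt (PosNum (divr_gt0 e0 (ltr0n _ 2))).
  by move=> [n _ /(_ n (leqnn n))]; exists n.
have [q qz] := rat_disc_dense (phi z) (r := radius n) ltac:(by rewrite invr_gt0).
have D0 : mu (D (q, n)) == 0.
  rewrite -measure_le0 -mu0 le_measure ?inE//.
  - exact: measurable_disc_preimage mphi (rad_ge0 n).
  - exact: measurable_disc_preimage mphi (ltW e0).
  move=> w Dw /=.
  have -> : phi w - phi z = (phi w - (ratr q.1 +i* ratr q.2)%C) -
      (phi z - (ratr q.1 +i* ratr q.2)%C) by ring.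
  apply: le_lt_trans (le_normcD _ _) _; rewrite normcN.
  by move: Dw qz; rewrite /D/=; lra.
exists (pickle (q, n)); first exact: I.
by rewrite /F pickleK D0.
Qed.

Lemma ae_le_Rintegral (h k : T -> R) : mu.-integrable setT (EFin \o h) ->
  mu.-integrable setT (EFin \o k) -> (\forall z \ae mu, h z <= k z) ->
  \int[mu]_z h z <= \int[mu]_z k z.
Proof.
move=> ih ik hk; rewrite -subr_ge0 -RintegralB// /Rintegral fine_ge0//.
have /integrableP[/measurable_EFinP mh _] := ih.
have /integrableP[/measurable_EFinP mk _] := ik.
(* Passing to the absolute value, equal to k - h almost everywhere, gives an integrand that is
   nonnegative at every point. *)
rewrite (@ae_eq_integral _ _ _ _ _ (fun z => `|k z - h z|%:E))//.
- by apply: integral_ge0 => z _; rewrite lee_fin.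
- by apply/measurable_EFinP; exact: measurable_funB.
- by apply/measurable_EFinP/measurableT_comp => //; exact: measurable_funB.
- by apply: filterS hk => z hkz _; rewrite ger0_norm ?subr_ge0.
Qed.

Lemma convex_hull_segment (A : set C) (x y : C) (t : R) : 0 <= t -> t <= 1 ->
  convex_hull A x -> convex_hull A y -> convex_hull A (x + t%:C%C * (y - x)).
Proof.
move=> t0 t1 Ax Ay M [cM AM].
have := cM y x (Itv01 t0 t1); rewrite !inE.
move=> /(_ (Ay M (conj cM AM)) (Ax M (conj cM AM))).
congr M; rewrite /conv /=.
case: x y {Ax Ay} => [a b] [c d]; apply/eqP; rewrite eq_complex /=.
by apply/andP; split; apply/eqP; rewrite /unstable.onem; ring.
Qed.

Lemma sub_convex_hull (A : set C) : A `<=` convex_hull A.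
Proof. by move=> x Ax M [_]; exact. Qed.

End essential_range.

(** * The lower bound *)

Section lower_bound.
Variable R : realType.
Local Notation C := R[i].
Local Notation T := (circle R).
Local Notation mu := (@circle_measure R).
Implicit Types f g phi : T -> C.

Lemma Lp_oo_bounded phi : Lp +oo%E phi ->
  exists2 M : R, 0 <= M & \forall z \ae mu, nsq (phi z) <= M.
Proof.
move=> [_ _]; rewrite /cnorm unlock /=; rewrite probability_setT lte01.
set s := ess_sup _ _ => sy.
have bound := ess_sup_ge mu (abse \o (fun z => (normc (phi z))%:E)).
(* The essential supremum is so far only an extended real below +oo; the value -oo is bounded by
   0. *)
have [r sr] : exists r : R, (s <= r%:E)%E.
  by case: s sy => [r _| //|_]; [exists r|exists 0; exact: leNye].
exists (r ^+ 2); first exact: sqr_ge0.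
apply: filterS bound => z /le_trans/(_ sr) /=.
rewrite lee_fin ger0_norm ?normc_ge0// => zr.
by rewrite -sqr_normc lerXn2r ?nnegrE ?(le_trans _ zr) ?normc_ge0.
Qed.

(** The coefficient of [2 * t] tells on which side of the line through [p] orthogonal to [p] the
    point [w] lies. Near-minimality of |p| on the segment keeps it from being very negative. *)
Lemma nsq_segment (p w : C) (t : R) : nsq (p + t%:C%C * (w - p)) =
  nsq p + 2 * t * (complex.Re (conjc p * w) - nsq p) + t ^+ 2 * nsq (w - p).
Proof. by case: p w => [a b] [c d]; rewrite /nsq /=; ring. Qed.

(* An almost nearest point of the hull to the origin almost separates the hull
   from the disc of radius [d], so that no compactness is needed. *)
Lemma dist0_separation phi (d : R) : Lp +oo%E phi ->
  dist0 (convex_hull (ess_ran phi)) = d%:E -> 0 <= d ->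
  forall e : R, 0 < e -> exists2 p : C, d ^+ 2 <= nsq p &
    \forall z \ae mu, nsq p - e <= complex.Re (conjc p * phi z).
Proof.
move=> Lphi dE d0 e e0; have [M M0 phiM] := Lp_oo_bounded Lphi.
have mphi : cmeasurable phi by have [] := Lphi.
have hull_ge w : convex_hull (ess_ran phi) w -> d ^+ 2 <= nsq w.
  move=> Aw; rewrite -sqr_normc lerXn2r ?nnegrE ?normc_ge0//.
  by rewrite -lee_fin -dE; apply: ereal_inf_lbound; exists w.
(* [B] bounds |phi z - p|^2 as soon as |p|^2 <= d^2 + 1. The choice of [t] makes the second-order
   term of [nsq_segment] at most t * e, and [r] keeps the excess of |p|^2 over d^2 below t * e;
   dividing the sum by 2 * t leaves exactly e. *)
pose B := 2 * (M + (d ^+ 2 + 1)).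
have B0 : 0 < B by rewrite /B; have := sqr_ge0 d; lra.
pose t := Num.min 1 (e / B).
have t0 : 0 < t by rewrite lt_min ltr01 divr_gt0.
have t1 : t <= 1 by rewrite ge_min lexx.
have tB : t * B <= e by rewrite -ler_pdivlMr// ge_min lexx orbT.
pose r := Num.min 1 (t * e).
have r0 : 0 < r by rewrite lt_min ltr01 mulr_gt0.
have r1 : r <= 1 by rewrite ge_min lexx.
have rt : r <= t * e by rewrite ge_min lexx orbT.
have [p Ap pd] : exists2 p, convex_hull (ess_ran phi) p & nsq p < d ^+ 2 + r.
  have : (dist0 (convex_hull (ess_ran phi)) < (Num.sqrt (d ^+ 2 + r))%:E)%E.
    rewrite dE lte_fin -{1}(ger0_norm d0) -sqrtr_sqr ltr_sqrt ?ltrDl//.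
    by have := sqr_ge0 d; lra.
  move=> /ereal_inf_lt[_ [p Ap <-]]; rewrite lte_fin => pr; exists p => //.
  move: pr; rewrite normcE ltr_sqrt//.
  by have := sqr_ge0 d; lra.
exists p; first exact: hull_ge.
have := ae_ess_ran mphi; apply: filterS2 phiM => z zM Az.
have := hull_ge _ (convex_hull_segment (ltW t0) t1 Ap (sub_convex_hull Az)).
have wB : nsq (phi z - p) <= B.
  apply: le_trans (nsqD_le _ _) _.
  have -> : nsq (- p) = nsq p by rewrite /nsq ReN ImN !sqrrN.
  by rewrite /B; lra.
rewrite nsq_segment; set x := complex.Re _ => H.
have tt : t ^+ 2 * nsq (phi z - p) <= t * e.
  rewrite expr2 -mulrA ler_pM2l//; apply: le_trans tB.
  by rewrite ler_pM2l.
suff : 0 <= 2 * t * (x - nsq p + e) by rewrite pmulr_rge0; lra.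
by nra.
Qed.

Lemma model_space_L2 (u : C -> C) : model_space u `<=` Lp 2%:E.
Proof. by move=> f [[]]. Qed.

Lemma dual_truncated_toeplitz_L2 (u : C -> C) phi f : Lp 2%:E (fun z => phi z * f z) ->
  Lp 2%:E (dual_truncated_toeplitz u phi f).
Proof.
by move=> Lf; have [] := orthoproj_contract (@model_space_L2 u) Lf.
Qed.

(** The part that the operator subtracts is a projection onto the model space, hence orthogonal to
    [f]. *)
Lemma cdot_dual_truncated_toeplitz (u : C -> C) phi f :
  Lp 2%:E (fun z => phi z * f z) -> model_space_perp u f ->
  cdot (dual_truncated_toeplitz u phi f) f = cdot (fun z => phi z * f z) f.
Proof.
move=> Lphif fK; have LD := dual_truncated_toeplitz_L2 u Lphif.
have Lf : Lp 2%:E f by case: fK.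
set P := orthoproj (model_space u) (fun z => phi z * f z).
have P0 : cdot P f = 0 := orthoproj_cdot _ (@model_space_L2 u) fK.
(* Square integrability of the projection is read off from phi f - D f, which covers the default
   value of [orthoproj] as well. *)
have LP : Lp 2%:E P.
  have := L2D Lphif (L2N LD).
  by congr (Lp _ _); apply/funext => z; rewrite /dual_truncated_toeplitz -/P; ring.
rewrite -[LHS]addr0 -P0 -cdotDl//; congr cdot; apply/funext => z.
by rewrite subrK.
Qed.

(** For the almost separating point p, |p|^2 - e/2 <= Re(conj p <D f, f>), while twice the right
    side is at most |D f|^2 + |p|^2 in norm. Together, d^2 <= |p|^2 <= |D f|^2 + e. *)
Lemma min_modulus_ge_dist0 (u : C -> C) phi : Lp +oo%E phi ->
  (dist0 (convex_hull (ess_ran phi)) <=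
    min_modulus (model_space_perp u) (dual_truncated_toeplitz u phi))%E.
Proof.
move=> Lphi; apply: le_ereal_inf_tmp => _ [f [fK f1] <-].
have mphi : cmeasurable phi by have [] := Lphi.
have [M M0 phiM] := Lp_oo_bounded Lphi.
have Lf : Lp 2%:E f by case: fK.
have Lphif := L2M_bounded mphi phiM Lf.
have LD := dual_truncated_toeplitz_L2 u Lphif.
have dotE := cdot_dual_truncated_toeplitz Lphif fK.
have nf1 : \int[mu]_z nsq (f z) = 1.
  move: f1; rewrite /= cnorm2_sqrt// => -[] /(congr1 (fun x => x ^+ 2)).
  by rewrite sqr_sqrtr ?nsq_integral_ge0// expr1n.
have dist0_ge0 : (0 <= dist0 (convex_hull (ess_ran phi)))%E.
  by apply: le_ereal_inf_tmp => _ [w _ <-]; rewrite lee_fin normc_ge0.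
(* If the hull were empty, [ae_ess_ran] would make the whole circle null. A point of the hull makes
   the distance finite. *)
have [w Aw] : exists w, convex_hull (ess_ran phi) w.
  apply: contrapT => /forallNP no_hull.
  have : mu.-negligible [set: T].
    apply: negligibleS (ae_ess_ran mphi) => z _ /= Az.
    exact: no_hull (sub_convex_hull Az).
  move=> /negligibleP => /(_ measurableT) muT0.
  by have /eqP := etrans (esym muT0) (probability_setT mu); rewrite eq_sym onee_eq0.
have dist0_fin : dist0 (convex_hull (ess_ran phi)) \is a fin_num.
  rewrite ge0_fin_numE//; apply: le_lt_trans (ltry (normc w)).
  by apply: ereal_inf_lbound; exists w.
rewrite -(fineK dist0_fin) cnorm2_sqrt// lee_fin.
set d := fine _; have d0 : 0 <= d by rewrite fine_ge0.
rewrite -(ger0_norm d0) -sqrtr_sqr ler_sqrt ?nsq_integral_ge0//.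
apply/ler_addgt0Pr => e e0.
have [p dp pphi] := dist0_separation Lphi (esym (fineK dist0_fin)) d0
  (divr_gt0 e0 (ltr0n _ 2)).
set D := dual_truncated_toeplitz u phi f in LD dotE *.
have iphif := cdot_integrable Lphif Lf; have iD := cdot_integrable LD Lf.
have /Lp2P[_ nf] := Lf; have /Lp2P[_ nD] := LD.
have Zf r := integrableZl measurableT r nf.
have nfZ r : \int[mu]_z (r * nsq (f z)) = r by rewrite RintegralZl// nf1 mulr1.
have ip g : cintegrable g -> mu.-integrable setT
    (EFin \o (fun z => complex.Re (conjc p * g z))).
  by move=> ig; have [] := cintegrableZ (conjc p) ig.
have Re_cdot g : cintegrable (fun z => g z * conjc (f z)) ->
    \int[mu]_z complex.Re (conjc p * (g z * conjc (f z))) =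
    complex.Re (conjc p * cdot g f).
  by move=> ig; rewrite -cintegralZ.
have low : nsq p - e / 2 <= complex.Re (conjc p * cdot D f).
  rewrite dotE -Re_cdot// -[leLHS]nfZ.
  apply: ae_le_Rintegral; [exact: Zf|exact: ip|].
  apply: filterS pphi => z pz.
  have -> : complex.Re (conjc p * (phi z * f z * conjc (f z))) =
      complex.Re (conjc p * phi z) * nsq (f z) by rewrite /nsq !ReImE; ring.
  by rewrite ler_wpM2r ?nsq_ge0.
(* Integrating |D f - p f|^2 >= 0 plays the role of the Cauchy-Schwarz inequality. *)
have upp : 2 * complex.Re (conjc p * cdot D f) <= \int[mu]_z nsq (D z) + nsq p.
  rewrite -Re_cdot// -[X in _ + X]nfZ -RintegralZl//; last exact: ip.
  rewrite -RintegralD//; last exact: Zf.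
  apply: le_Rintegral => //.
  - exact: (integrableZl measurableT 2 (ip _ iD)).
  - exact: (integrableD measurableT nD (Zf (nsq p))).
  move=> z _; rewrite -subr_ge0.
  by rewrite (_ : _ - _ = nsq (D z - p * f z)) ?nsq_ge0// /nsq !ReImE; ring.
by move: low upp dp; rewrite -/d; lra.
Qed.

End lower_bound.

(** * Polynomials approximating the indicator of an arc *)

Section cutoff_powers.
Variable R : realType.
Implicit Types x y t s r : R.

Lemma bernoulli_lower y n : 0 <= y -> y <= 1 -> 1 - n%:R * y <= (1 - y) ^+ n.
Proof.
move=> y0 y1; elim: n => [|n IH]; first by rewrite mul0r subr0 expr0.
rewrite exprS -natr1; apply: le_trans (ler_wpM2l _ IH); last by rewrite subr_ge0.
by have := mulr_ge0 (ler0n R n) (mulr_ge0 y0 y0); nra.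
Qed.

(** Bernoulli's bound for (1 + y)^n, combined with (1 - y)^n (1 + y)^n = (1 - y^2)^n <= 1. *)
Lemma bernoulli_upper y n : 0 <= y -> y <= 1 -> (1 - y) ^+ n * (1 + n%:R * y) <= 1.
Proof.
move=> y0 y1.
have H : 1 + n%:R * y <= (1 + y) ^+ n.
  elim: n => [|n IH]; first by rewrite mul0r addr0 expr0.
  rewrite exprS -natr1; apply: le_trans (ler_wpM2l _ IH); last by rewrite addr_ge0.
  by have := mulr_ge0 (ler0n R n) (mulr_ge0 y0 y0); nra.
apply: (@le_trans _ _ ((1 - y) ^+ n * (1 + y) ^+ n)).
  by apply: ler_wpM2l H; rewrite exprn_ge0// subr_ge0.
rewrite -exprMn exprn_ile1//; first by rewrite mulr_ge0 ?subr_ge0// addr_ge0.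
by nra.
Qed.

(** A sharp threshold at x = 1/2: by the two Bernoulli bounds its size is governed by 2^n x^n =
    (2x)^n, which tends to 0 below 1/2 and to infinity above. *)
Definition cutoff n x := (1 - x ^+ n) ^+ (2 ^ n)%N.

Lemma cutoff_ge0 n x : 0 <= x -> x <= 1 -> 0 <= cutoff n x.
Proof. by move=> x0 x1; rewrite exprn_ge0// subr_ge0 exprn_ile1. Qed.

Lemma cutoff_le1 n x : 0 <= x -> x <= 1 -> cutoff n x <= 1.
Proof.
move=> x0 x1; rewrite exprn_ile1//; first by rewrite subr_ge0 exprn_ile1.
by rewrite gerBl exprn_ge0.
Qed.

Lemma cutoff_cvg1 x : 0 <= x -> x < 1 / 2 -> cutoff ^~ x @ \oo --> (1 : R).
Proof.
move=> x0 x2; have x1 : x <= 1 by lra.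
have cvg2x : (fun n => 1 - (2 * x) ^+ n) @ \oo --> (1 : R).
  rewrite -[X in _ --> X]subr0; apply: cvgB; first exact: cvg_cst.
  by apply: cvg_expr; rewrite ger0_norm ?mulr_ge0//; lra.
apply: squeeze_cvgr cvg2x (cvg_cst _); apply: nearW => n.
rewrite cutoff_le1// andbT exprMn -natrX.
by apply: bernoulli_lower; rewrite ?exprn_ge0// exprn_ile1.
Qed.

Lemma cutoff_cvg0 x : 1 / 2 < x -> x <= 1 -> cutoff ^~ x @ \oo --> (0 : R).
Proof.
move=> x2 x1; have x0 : 0 < x by lra.
have x20 : 0 < 2 * x by lra.
have cvg2x : (fun n => (2 * x)^-1 ^+ n) @ \oo --> (0 : R).
  apply: cvg_expr; rewrite ger0_norm ?invr_ge0 ?(ltW x20)// invf_lt1//; lra.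
apply: squeeze_cvgr (cvg_cst _) cvg2x; apply: nearW => n.
rewrite (cutoff_ge0 _ (ltW x0) x1)/= exprVn -[leRHS]mul1r ler_pdivlMr ?exprn_gt0//.
have xn0 : 0 <= x ^+ n by rewrite exprn_ge0// ltW.
have xn1 : x ^+ n <= 1 by rewrite exprn_ile1// (ltW x0).
have := bernoulli_upper (2 ^ n) xn0 xn1; apply: le_trans.
apply: ler_wpM2l; first exact: cutoff_ge0 (ltW x0) x1.
by rewrite exprMn natrX lerDr.
Qed.

(* Scaled so that the transition of [cutoff] at [1 / 2] sits at [|t - s| = r]. *)
Definition cosine_level s r t : R :=
  1 / 2 + (cos (2 * pi * r) - cos (2 * pi * (t - s))) / 4.

Lemma cosine_level_itv s r t : 0 <= cosine_level s r t <= 1.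
Proof.
have := cos_geN1 (2 * pi * r); have := cos_le1 (2 * pi * r).
have := cos_geN1 (2 * pi * (t - s)); have := cos_le1 (2 * pi * (t - s)).
by rewrite /cosine_level => *; apply/andP; split; lra.
Qed.

Lemma cosine_levelE s r t : cosine_level s r t =
  1 / 2 + (cos (2 * pi * r) - cos (2 * pi * `|t - s|)) / 4.
Proof.
rewrite /cosine_level -[cos (_ * (t - s))]cos_norm normrM (ger0_norm (x := 2 * pi))//.
by rewrite mulr_ge0// pi_ge0.
Qed.

Lemma cosine_level_in s r t : r <= 1 / 2 -> `|t - s| < r ->
  cosine_level s r t < 1 / 2.
Proof.
move=> r2 tr; rewrite cosine_levelE; have pi0 := pi_gt0 R.
have tr0 := normr_ge0 (t - s).
suff : cos (2 * pi * r) < cos (2 * pi * `|t - s|) by lra.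
rewrite ltr_cos ?in_itv/=; first by rewrite ltr_pM2l// mulr_gt0.
- by apply/andP; split; nra.
- by apply/andP; split; nra.
Qed.

Lemma cosine_level_out s r t : 0 <= r -> r <= 1 / 2 -> r < `|t - s| < 1 - r ->
  1 / 2 < cosine_level s r t.
Proof.
move=> r0 r2 /andP[rt tr]; rewrite cosine_levelE; have pi0 := pi_gt0 R.
move: rt tr; set y := `|t - s| => rt tr.
suff : cos (2 * pi * y) < cos (2 * pi * r) by lra.
have [y2|y2] := leP y (1 / 2).
  rewrite ltr_cos ?in_itv/=; first by rewrite ltr_pM2l// mulr_gt0.
  - by apply/andP; split; nra.
  - by apply/andP; split; nra.
(* Beyond half a turn, reflecting [y] to [1 - y] brings the angle back to [0, pi], where the cosine
   decreases. *)
have -> : cos (2 * pi * y) = cos (2 * pi * (1 - y)).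
  rewrite -cosN -(cosD2pi (- _)); congr cos.
  by rewrite mulr2n; ring.
rewrite ltr_cos ?in_itv/=; first by rewrite ltr_pM2l ?mulr_gt0//; lra.
- by apply/andP; split; nra.
- by apply/andP; split; nra.
Qed.

(** Here [z] is the centre of the arc. For a variable w on the circle, cos(2 pi (t - s)) = (w conj z
    + z conj w) / 2; multiplying [cosine_level] by w clears conj w and yields the coefficients 1/8.
    Using ['X^n] in place of 1 balances the resulting factor w^n, so that the modulus is
    unaffected. *)
Definition cutoff_poly n s r : {poly R[i]} :=
  let z := expi_val s in
  let q := ((1 / 2 + cos (2 * pi * r) / 4)%:C%C)%:P * 'X
    - ((1 / 8)%:C%C * conjc z)%:P * 'X^2 - ((1 / 8)%:C%C * z)%:P in
  ('X^n - q ^+ n) ^+ (2 ^ n)%N.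

Lemma nsq_real x : nsq (x%:C%C) = x ^+ 2.
Proof. by rewrite /nsq /= expr0n addr0. Qed.

(* On the circle [q] takes the value [z * cosine_level s r t] at
   [z = exp (2 pi i t)]. *)
Lemma nsq_cutoff_poly n s r t :
  nsq (cutoff_poly n s r).[sval (expi t)] = cutoff n (cosine_level s r t) ^+ 2.
Proof.
have z1 := nsq_circle (expi t).
rewrite /cutoff_poly !(hornerE, horner_exp).
set w := (X in (_ ^+ n - X ^+ n)).
have -> : w = sval (expi t) * (cosine_level s r t)%:C%C.
  rewrite /w /cosine_level mulrBr cosB /=.
  have sin2 : sin (2 * pi * t) ^+ 2 = 1 - cos (2 * pi * t) ^+ 2 by exact: sin2cos2.
  apply/eqP; rewrite eq_complex !ReImE /=; apply/andP; split; apply/eqP.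
    by field: sin2.
  by field: sin2.
rewrite nsqX exprMn -{1}[sval (expi t) ^+ n]mulr1 -mulrBr nsqM nsqX z1 expr1n mul1r.
rewrite -rmorphXn -(rmorph1 (@real_complex R)) -rmorphB nsq_real.
by rewrite /cutoff -!exprM mulnC.
Qed.

End cutoff_powers.

(** * Means over arcs *)

Section circle_transfer.
Variable R : realType.
Local Notation C := R[i].
Local Notation T := (circle R).
Local Notation mu := (@circle_measure R).
Local Notation leb := (@lebesgue_measure R).
Local Notation I01 := (`[0, 1[%classic : set R).
Local Open Scope ereal_scope.

(* The type on which [lebesgue_measure] lives is an alias of [R]. *)
Lemma expi_measurable :
  @measurable_fun _ _ (g_sigma_algebraType (R.-ocitv.-measurable)) T setT (@expi R).
Proof. exact: measurable_expi. Qed.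

Lemma ge0_integral_circle (k : T -> \bar R) : measurable_fun setT k ->
  (forall z, 0 <= k z) -> \int[mu]_z k z = \int[leb]_(t in I01) k (expi t).
Proof.
move=> mk k0; pose mI := measurable_itv `[0%R : R, 1%R[.
have k0' : {in [set: T], forall z, 0 <= k z} by move=> z _.
have pushE := ge0_integral_pushforward expi_measurable (mrestr leb mI)
  measurableT mk k0'.
transitivity (\int[pushforward (mrestr leb mI) (@expi R)]_z k z); first by [].
rewrite pushE preimage_setT.
have mke := measurableT_comp mk expi_measurable.
(* The restricted measure vanishes off [0, 1[ and agrees with Lebesgue measure on subsets of it. *)
have outside0 : mrestr leb mI (~` I01) = 0 by rewrite /mrestr setICl measure0.
have -> := @ge0_negligible_integral _ _ R (mrestr leb mI) setT (~` I01)
  (k \o @expi R) (measurableC mI) measurableT mke (fun t _ => k0 _) outside0.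
rewrite setTD setCK; apply: eq_measure_integral => A mA AI /=.
by rewrite /mrestr setIidl.
Qed.

Lemma integral_circle (k : T -> \bar R) : measurable_fun setT k ->
  \int[mu]_z k z = \int[leb]_(t in I01) k (expi t).
Proof.
move=> mk; rewrite integralE [RHS]integralE; congr (_ - _).
  apply: etrans (ge0_integral_circle (measurable_funepos mk) (funepos_ge0 _)) _.
  by apply: eq_integral => t _; rewrite !funeposE.
apply: etrans (ge0_integral_circle (measurable_funeneg mk) (funeneg_ge0 _)) _.
by apply: eq_integral => t _; rewrite !funenegE.
Qed.

Lemma integrable_circle (k : T -> \bar R) :
  mu.-integrable setT k -> leb.-integrable I01 (k \o @expi R).
Proof.
move=> /integrableP[mk ki]; apply/integrableP; split.
  exact: (measurable_funTS (measurableT_comp mk expi_measurable)).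
rewrite -(ge0_integral_circle (k := fun z => `|k z|))//.
exact: measurableT_comp.
Qed.

End circle_transfer.

(** * Nonnegativity almost everywhere from integrals against squared moduli of polynomials *)

Section averages.
Variable R : realType.
Local Notation C := R[i].
Local Notation T := (circle R).
Local Notation mu := (@circle_measure R).
Local Notation leb := (@lebesgue_measure R).
Local Notation I01 := (`[0, 1[%classic : set R).

(** The hypothesis applied to [cutoff_poly n s r] passes to the limit by dominated convergence, with
    |g| as the dominating function. *)
Lemma ball_integral_ge0 (g : T -> R) (s r : R) :
  mu.-integrable setT (EFin \o g) ->
  (forall p : {poly C},
    mu.-integrable setT (EFin \o (fun z => g z * nsq p.[sval z]))) ->
  (forall p : {poly C}, 0 <= \int[mu]_z (g z * nsq p.[sval z])) ->
  0 < r -> 0 < s - r -> s + r < 1 ->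
  (0 <= \int[leb]_(t in ball s r) (g (expi t))%:E)%E.
Proof.
move=> ig ip gp r0 sr0 sr1; have mI : measurable I01 by exact: measurable_itv.
have iG := integrable_circle ig; have /integrableP[mG _] := iG.
have /integrableP[/measurable_EFinP mg _] := ig.
have r2 : r <= 1 / 2 by lra.
pose h n t := (g (expi t) * cutoff n (cosine_level s r t) ^+ 2)%:E.
have mp n : measurable_fun setT (fun z : T => nsq (cutoff_poly n s r).[sval z]).
  by have /Lp2P[/measurable_nsq] := L2_poly (cutoff_poly n s r).
have mk n : measurable_fun setT
    (fun z : T => (g z * nsq (cutoff_poly n s r).[sval z])%:E).
  by apply/measurable_EFinP; exact: measurable_funM.
have hE n : (\int[mu]_z (g z * nsq (cutoff_poly n s r).[sval z])%:E =
    \int[leb]_(t in I01) h n t)%E.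
  rewrite integral_circle//; apply: eq_integral => t _.
  by rewrite nsq_cutoff_poly.
have mh n : measurable_fun I01 (h n).
  apply/measurable_funTS; have := measurableT_comp (mk n) (@expi_measurable R).
  by congr measurable_fun; apply/funext => t /=; rewrite nsq_cutoff_poly.
have h_le n t : (`|h n t| <= `|(g (expi t))%:E|)%E.
  have /andP[x0 x1] := cosine_level_itv s r t.
  have c0 := cutoff_ge0 n x0 x1; have c1 := cutoff_le1 n x0 x1.
  rewrite lee_fin normrM (ger0_norm (exprn_ge0 2 c0)).
  by rewrite ler_piMr// exprn_ile1.
pose f := (fun t => (g (expi t))%:E) \_ (ball s r).
have mf : measurable_fun I01 f.
  apply/(measurable_restrict _ (measurable_ball s r) mI).
  by apply: measurable_funS mG => //; exact: subIsetl.
have hf : {ae leb, forall t, I01 t -> h ^~ t @ \oo --> f t}.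
  (* At the two endpoints the level is exactly 1/2, where [cutoff] tends neither to 0 nor to 1; they
     form a null exceptional set. *)
  have leb0 : leb ([set s - r] `|` [set s + r]) = 0%E.
    apply: countable_lebesgue_measure0; apply: finite_set_countable.
    by rewrite finite_setU; split; exact: finite_set1.
  exists ([set s - r] `|` [set s + r]); split => //; first exact: measurableU.
  move=> t /= /not_implyP[]; rewrite in_itv/= => /andP[t0 t1]; apply: contra_notP.
  move=> /not_orP[tl tr].
  have /andP[x0 x1] := cosine_level_itv s r t.
  have sq : (fun n => cutoff n (cosine_level s r t) ^+ 2) @ \oo -->
      (\1_(ball s r) t : R).
    have [tin|tout] := boolP (`|t - s| < r).
      rewrite indicE mem_set/=; last by rewrite -ball_normE /= distrC.
      rewrite -[X in _ --> X](mulr1 1); under eq_fun do rewrite expr2.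
      have := cutoff_cvg1 x0 (cosine_level_in r2 tin).
      by move=> c; exact: (cvgM c c).
    rewrite indicE memNset/=; last by rewrite -ball_normE /= distrC; exact/negP.
    rewrite -[X in _ --> X](mulr0 0); under eq_fun do rewrite expr2.
    (* The upper bound 1 - r expresses that the arc stays inside ]0, 1[, so [t] is not close to [s]
       the other way round the circle. *)
    have rt : r < `|t - s| < 1 - r.
      rewrite lt_neqAle leNgt tout andbT ltr_norml; apply/and3P; split; [|lra|lra].
      apply/eqP => rE; have [ts|ts] := leP 0 (t - s).
        by apply: tr => /=; move: rE; rewrite ger0_norm//; lra.
      by apply: tl => /=; move: rE; rewrite ltr0_norm//; lra.
    have := cutoff_cvg0 (cosine_level_out (ltW r0) r2 rt) x1.
    by move=> c; exact: (cvgM c c).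
  rewrite (_ : f t = (g (expi t) * \1_(ball s r) t)%:E); last first.
    rewrite /f patchE indicE; case: ifP => _ /=; by rewrite ?mulr1 ?mulr0.
  by apply: cvg_EFin; [exact: nearW|exact: (cvgMl_tmp sq)].
have abs_le : {ae leb, forall t n, I01 t -> (`|h n t| <= `|(g (expi t))%:E|)%E}.
  by apply: aeW => t n _.
have [_ _ hlim] := @dominated_convergence _ _ _ leb I01 mI h f _ mh mf hf
  (integrable_abse iG) abs_le.
rewrite -(setIidr (_ : ball s r `<=` I01)); last first.
  by move=> t; rewrite ball_itv/= !in_itv/= => /andP[? ?]; apply/andP; split; lra.
rewrite integral_mkcondr -/f -(cvg_lim _ hlim)//.
apply: lime_ge; first by apply/cvg_ex; eexists; exact: hlim.
apply: nearW => n /=; rewrite -hE.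
rewrite -(fineK (integrable_fin_num measurableT (ip _))) lee_fin.
exact: gp.
Qed.

(** If g took the value -c < 0 at the point, nonnegative means over small arcs would force the mean
    of |g + c| to be at least c, whereas it tends to 0 at a Lebesgue point. Excluding [t = 0] leaves
    room for a ball inside [0, 1[. *)
Lemma lebesgue_pt_ge0 (g : T -> R) (t : R) : mu.-integrable setT (EFin \o g) ->
  (forall p : {poly C},
    mu.-integrable setT (EFin \o (fun z => g z * nsq p.[sval z]))) ->
  (forall p : {poly C}, 0 <= \int[mu]_z (g z * nsq p.[sval z])) ->
  I01 t -> t != 0 -> lebesgue_pt ((g \o @expi R) \_ I01) t -> 0 <= g (expi t).
Proof.
move=> ig ip gp It t0; have mI : measurable I01 by exact: measurable_itv.
have := It; rewrite /= in_itv/= le_eqVlt eq_sym (negbTE t0)/= => /andP[t_gt0 t_lt1].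
set G := _ \_ _ => Lt; rewrite leNgt; apply/negP => gt0.
pose c := - g (expi t); have c0 : 0 < c by rewrite oppr_gt0.
have iG := integrable_circle ig.
suff : (c%:E <= 0)%E by rewrite lee_fin leNgt c0.
apply: (cvge_to_ge Lt); near=> r.
have r0 : 0 < r by near: r; exact: nbhs_right_gt.
have rt : 0 < t - r by rewrite subr_gt0; near: r; exact: nbhs_right_lt.
have rt1 : t + r < 1.
  by rewrite -ltrBrDl; near: r; apply: nbhs_right_lt; rewrite subr_gt0.
have mB : measurable (ball t r) by exact: measurable_ball.
have BI : ball t r `<=` I01.
  by move=> y; rewrite ball_itv/= !in_itv/= => /andP[? ?]; apply/andP; split; lra.
have iB := @integrableS _ _ _ leb I01 (ball t r) _ mI mB BI iG.
have lebB : leb (ball t r) = (r *+ 2)%:E by exact: lebesgue_measure_ball (ltW r0).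
have ic : leb.-integrable (ball t r) (EFin \o cst c).
  have lebBy : (leb (ball t r) < +oo)%E by rewrite lebB ltry.
  exact: (@measurable_bounded_integrable _ _ _ leb _ _ mB lebBy
    (measurable_cst _) (bounded_cst _ _)).
have ik := @integrableD _ _ _ leb _ mB _ _ iB ic.
rewrite /davg /iavg lebB inver mulrn_eq0/= gt_eqF// -[leLHS]mul1e.
rewrite (_ : 1%E = ((r *+ 2)^-1%:E * (r *+ 2)%:E)%E); last first.
  by rewrite -EFinM mulVf// mulrn_eq0/= gt_eqF.
rewrite -muleA; apply: lee_wpmul2l; first by rewrite lee_fin invr_ge0 mulrn_wge0// ltW.
have low : ((r *+ 2)%:E * c%:E <= \int[leb]_(y in ball t r)
    ((EFin \o g \o @expi R) y + (EFin \o cst c) y))%E.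
  rewrite integralD// [X in (_ <= _ + X)%E](_ : _ = (r *+ 2)%:E * c%:E)%E.
    by apply: leeDr; exact: ball_integral_ge0 ig ip gp r0 rt rt1.
  by apply: etrans (@integral_cst _ _ _ leb _ mB c%:E) _; rewrite muleC; congr (_ * _)%E.
apply: le_trans low _.
rewrite [leRHS](_ : _ = \int[leb]_(y in ball t r)
    `|(EFin \o g \o @expi R) y + (EFin \o cst c) y|)%E; last first.
  apply: eq_integral => y; rewrite inE => /BI Iy /=.
  by rewrite /G !patchE !mem_set//= /c -EFinD.
apply: (@le_integral _ _ _ leb _ mB _ _ ik (integrable_abse ik)) => y _.
exact: lee_abs.
Unshelve. all: by end_near. Qed.

Lemma ae_ge0_of_poly (g : T -> R) : mu.-integrable setT (EFin \o g) ->
  (forall p : {poly C},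
    mu.-integrable setT (EFin \o (fun z => g z * nsq p.[sval z]))) ->
  (forall p : {poly C}, 0 <= \int[mu]_z (g z * nsq p.[sval z])) ->
  \forall z \ae mu, 0 <= g z.
Proof.
move=> ig ip gp; have mI : measurable I01 by exact: measurable_itv.
have iG := integrable_circle ig; have /integrableP[/measurable_EFinP mg _] := ig.
pose G := (g \o @expi R) \_ I01.
have lG : locally_integrable setT G by exact: integrable_locally_restrict.
have [N [mN N0 subN]] := lebesgue_differentiation lG.
have mneg : measurable [set z : T | g z < 0].
  rewrite -[X in measurable X]setTI.
  have := mg measurableT _ (measurable_itv `]-oo, (0 : R)[).
  by congr (measurable (_ `&` _)); apply/seteqP; split=> z /=; rewrite in_itv.
have : mu.-negligible [set z : T | g z < 0].
  apply/negligibleP => //; apply/eqP; rewrite -measure_le0.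
  (* The point 0 joins the exceptional set of Lebesgue differentiation because [lebesgue_pt_ge0]
     excludes it. *)
  have -> : 0%E = leb (N `|` [set 0]).
    by rewrite measureU0//; exact: lebesgue_measure_set1.
  apply: le_measure; rewrite ?inE.
  - apply: measurableI => //; rewrite -[X in measurable X]setTI.
    exact: expi_measurable mneg.
  - exact: measurableU.
  move=> t [gt It]; have [->|t0] := eqVneq t 0; first by right.
  left; apply: subN => /= /(lebesgue_pt_ge0 ig ip gp It t0).
  by rewrite leNgt => /negP; apply.
by apply: negligibleS => z /= /negP; rewrite -ltNge.
Qed.

End averages.

(** * The upper bound *)

Section upper_bound.
Variable R : realType.
Local Notation C := R[i].
Local Notation T := (circle R).
Local Notation mu := (@circle_measure R).
Implicit Types (f g phi : T -> C) (p : {poly C}).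

(* Multiplying by a power of [conjc z] moves an analytic polynomial into the
   orthogonal complement of the Hardy space without changing its modulus. *)
Lemma model_space_perp_poly (u : C -> C) p :
  model_space_perp u (fun z => conjc (sval z) ^+ size p * p.[sval z]).
Proof.
have [Lf f0] := orthocompl_hardy2_poly (leqnn (size p)).
by split=> // g [Hg _]; exact: f0.
Qed.

(** The test vector of [model_space_perp_poly] has the modulus of [p], hence norm 1, and removing
    the projection does not increase the norm of phi f. *)
Lemma min_modulus_le_poly (u : C -> C) phi p : Lp +oo%E phi ->
  \int[mu]_z nsq p.[sval z] = 1 ->
  (min_modulus (model_space_perp u) (dual_truncated_toeplitz u phi) <=
    (Num.sqrt (\int[mu]_z (nsq (phi z) * nsq p.[sval z])))%:E)%E.
Proof.
move=> Lphi p1; have mphi : cmeasurable phi by have [] := Lphi.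
have [M M0 phiM] := Lp_oo_bounded Lphi.
have fK := model_space_perp_poly u p.
set f := (fun z => _) in fK; have Lf : Lp 2%:E f by case: fK.
have nf z : nsq (f z) = nsq p.[sval z].
  by rewrite nsqM nsqX nsq_conj nsq_circle expr1n mul1r.
have Lphif := L2M_bounded mphi phiM Lf.
have [LD Dle] := orthoproj_contract (@model_space_L2 _ u) Lphif.
apply: (@le_trans _ _ (cnorm 2%:E (dual_truncated_toeplitz u phi f))).
  apply: ereal_inf_lbound; exists f => //; split => //=.
  by rewrite cnorm2_sqrt//; under eq_Rintegral do rewrite nf; rewrite p1 sqrtr1.
rewrite cnorm2_sqrt// lee_fin ler_wsqrtr//; apply: le_trans Dle _.
by rewrite le_eqVlt; apply/orP; left; apply/eqP/eq_Rintegral => z _;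
  rewrite nsqM nf.
Qed.

Lemma min_modulus_le_ess_inf (u : C -> C) phi : Lp +oo%E phi ->
  (min_modulus (model_space_perp u) (dual_truncated_toeplitz u phi) <=
    ess_inf mu (fun z => (normc (phi z))%:E))%E.
Proof.
move=> Lphi; have mphi : cmeasurable phi by have [] := Lphi.
have [M M0 phiM] := Lp_oo_bounded Lphi.
set m := min_modulus _ _.
have m_ge0 : (0 <= m)%E.
  by apply: le_ereal_inf_tmp => _ [f _ <-]; exact: Lnorm_ge0.
(* The constant polynomial 1 already gives a finite upper bound. *)
have m_fin : m \is a fin_num.
  rewrite ge0_fin_numE//; apply: le_lt_trans (min_modulus_le_poly u (p := 1) Lphi _) _.
    under eq_Rintegral do rewrite hornerC -(expr0 1) nsqX expr0.
    by rewrite Rintegral_cst// mul1r; exact: (congr1 fine (probability_setT mu)).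
  exact: ltry.
pose m0 := fine m; have m0_ge0 : 0 <= m0 by rewrite fine_ge0.
have ip p : mu.-integrable setT (EFin \o (fun z => nsq p.[sval z])).
  by have /Lp2P[] := L2_poly p.
have ipp p : mu.-integrable setT (EFin \o (fun z => nsq (phi z) * nsq p.[sval z])).
  have /Lp2P[_ i] := L2M_bounded mphi phiM (L2_poly p).
  by apply: eq_integrable i => // z _; rewrite /= nsqM.
have iphi : mu.-integrable setT (EFin \o (fun z => nsq (phi z))).
  have /Lp2P[_ i] := L2M_bounded mphi phiM (L2_cst 1).
  by apply: eq_integrable i => // z _; rewrite /= mulr1.
have poly_le p : m0 ^+ 2 * \int[mu]_z nsq p.[sval z] <=
    \int[mu]_z (nsq (phi z) * nsq p.[sval z]).
  set N := \int[mu]_z nsq p.[sval z].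
  have : 0 <= N by apply: Rintegral_ge0 => z _; exact: nsq_ge0.
  rewrite le_eqVlt => /predU1P[<-|N0].
    by rewrite mulr0; apply: Rintegral_ge0 => z _; rewrite mulr_ge0 ?nsq_ge0.
  (* Normalisation by the norm of [p] reduces the inequality to unit vectors; the case of norm 0 was
     settled just before. *)
  pose q := ((Num.sqrt N)^-1%:C)%C *: p.
  have nq z : nsq q.[sval z] = N^-1 * nsq p.[sval z].
    by rewrite hornerZ nsqM nsq_real exprVn sqr_sqrtr// ltW.
  have q1 : \int[mu]_z nsq q.[sval z] = 1.
    by under eq_Rintegral do rewrite nq; rewrite RintegralZl// mulVf ?gt_eqF.
  have := min_modulus_le_poly u Lphi q1.
  rewrite -/m -(fineK m_fin) lee_fin -/m0.
  under eq_Rintegral do rewrite nq mulrCA.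
  rewrite RintegralZl//; set J := \int[mu]_z _ => mJ.
  have J0 : 0 <= J by apply: Rintegral_ge0 => z _; rewrite mulr_ge0 ?nsq_ge0.
  rewrite -ler_pdivlMr// mulrC.
  rewrite -[leRHS]sqr_sqrtr; last by rewrite mulr_ge0// invr_ge0 ltW.
  by rewrite lerXn2r ?nnegrE ?sqrtr_ge0.
have im p := integrableZl measurableT (m0 ^+ 2) (ip p).
have gE p : (fun z => (nsq (phi z) - m0 ^+ 2) * nsq p.[sval z]) =
  (fun z => nsq (phi z) * nsq p.[sval z] - m0 ^+ 2 * nsq p.[sval z]).
  by apply/funext => z; rewrite mulrBl.
(* By [poly_le], |phi|^2 - m0^2 has a nonnegative integral against every |p|^2. *)
have ae_ge0 := @ae_ge0_of_poly _ (fun z => nsq (phi z) - m0 ^+ 2).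
apply/ess_infP; rewrite -(fineK m_fin).
apply: filterS (ae_ge0 _ _ _) => [z||p|p].
- rewrite subr_ge0 lee_fin -sqr_normc => mz.
  by rewrite -ler_sqr ?nnegrE ?normc_ge0.
- have ic : mu.-integrable setT (EFin \o (fun=> m0 ^+ 2)).
    by have [] := L2_cintegrable (L2_cst ((m0 ^+ 2)%:C)%C).
  exact: (integrableB measurableT iphi ic).
- by rewrite gE; exact: (integrableB measurableT (ipp p) (im p)).
rewrite gE RintegralB//; last exact: im.
by rewrite subr_ge0 RintegralZl.
Qed.

End upper_bound.

Local Open Scope ereal_scope.

Theorem proposition4p1 (R : realType) (u : R[i] -> R[i])
    (phi : circle R -> R[i])
    (u_inner : inner_function u)
    (u_nonconstant : ~ constant_on_disc u)
    (phi_bounded : Lp +oo phi)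
    (D_normal : normal_operator (model_space_perp u)
                  (dual_truncated_toeplitz u phi)) :
  dist0 (convex_hull (ess_ran phi)) <=
    min_modulus (model_space_perp u) (dual_truncated_toeplitz u phi)
  /\
  min_modulus (model_space_perp u) (dual_truncated_toeplitz u phi) <=
    ess_inf circle_measure (fun z => (normc (phi z))%:E).
Proof.
by split; [exact: min_modulus_ge_dist0|exact: min_modulus_le_ess_inf].
Qed.
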